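(* Let $X\subset\mathbb{R}^n$ be a closed definable set with $0\in \mathrm{Sng}_2X\cap \mathrm{Reg}_1X$. If $0\in\mathcal{SQ}(X)$ (that is, $X$ is superquadratic at $0$), then $0\in\overline{M_X}$.
   Context: Fix an o-minimal structure expanding the field $\mathbb{R}$; ''definable'' means definable in it. $\mathbb{R}^n$ carries the Euclidean norm. For a closed nonempty $X\subset\mathbb{R}^n$ and $a\in\mathbb{R}^n$ put $d(a,X)=\inf\{\|a-x\| : x\in X\}$ and $m(a)=\{x\in X : \|a-x\|=d(a,X)\}$. The medial axis of $X$ is $M_X=\{a\in\mathbb{R}^n : \#m(a)>1\}$, and $\overline{M_X}$ is its closure in $\mathbb{R}^n$. $\mathrm{Reg}_kX$ is the set of points $x\in X$ having a neighbourhood $U$ in $\mathbb{R}^n$ such that $X\cap U$ is a $\mathscr{C}^k$-submanifold of $\mathbb{R}^n$ (without boundary); $\mathrm{Sng}_kX=X\setminus \mathrm{Reg}_kX$. Superquadracity: let $X\subset\mathbb{R}^n$ be closed and definable, $a\in \mathrm{Sng}_2X\cap \mathrm{Reg}_1X$, and let $p$ be the orthogonal projection onto the affine tangent space $a+T_aX$. For a sufficiently small closed ball $U$ centred at $a$ put $g(\varepsilon)=\max\{\|x-p(x)\| : x\in X\cap U,\ \|p(x)-a\|=\varepsilon\}$ for small $\varepsilon>0$ (for $\varepsilon$ small enough the value does not depend on the choice of small $U$). $X$ is superquadratic at $a$ if $\lim_{\varepsilon\to0^+}g(\varepsilon)/\varepsilon^2=+\infty$. $\mathcal{SQ}(X)$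 is the set of all points of $X$ at which $X$ is superquadratic. *)

(* Defs.v *)
From HB Require Import structures.
From mathcomp Require Import all_boot all_order all_algebra.
From mathcomp Require Import all_classical all_reals all_analysis.
Set Implicit Arguments.
Unset Strict Implicit.
Unset Printing Implicit Defensive.
Import Order.TTheory GRing.Theory Num.Theory.
Import numFieldNormedType.Exports.
Local Open Scope classical_set_scope.
Local Open Scope ring_scope.

(* O-minimal structures expanding the field R, in van den Dries' presentation.
   In definable_line, the type [interval R] also contains the degenerate
   intervals `[c, c], i.e. the points, and the unbounded ones. *)
Record ominimal (R : realType) := Ominimal {
  definable : forall n : nat, set (set 'rV[R]_n) ;
  definableT : forall n, definable [set: 'rV[R]_n] ;
  definableC : forall n (A : set 'rV[R]_n), definable A -> definable (~` A) ;
  definableU : forall n (A B : set 'rV[R]_n),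
    definable A -> definable B -> definable (A `|` B) ;
  definable_prodr : forall n (A : set 'rV[R]_n), definable A ->
    definable [set x : 'rV[R]_(n + 1) | A (lsubmx x)] ;
  definable_prodl : forall n (A : set 'rV[R]_n), definable A ->
    definable [set x : 'rV[R]_(1 + n) | A (rsubmx x)] ;
  definable_proj : forall n (A : set 'rV[R]_(n + 1)), definable A ->
    definable [set lsubmx x | x in A] ;
  definable_diag : forall n,
    definable [set x : 'rV[R]_n.+1 | x 0 ord0 = x 0 ord_max] ;
  definable_lt : definable [set x : 'rV[R]_2 | x 0 0 < x 0 1] ;
  definable_add : definable [set x : 'rV[R]_3 | x 0 0 + x 0 1 = x 0 2] ;
  definable_mul : definable [set x : 'rV[R]_3 | x 0 0 * x 0 1 = x 0 2] ;
  definable_line : forall A : set 'rV[R]_1, definable A <->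
    exists s : seq (interval R),
      A = [set x | has (fun I : interval R => x 0 0 \in I) s]
}.
Arguments definable {R} _ {n} _.

Section Euclidean.
Context {R : realType} {n : nat}.
Implicit Types (a u v x y : 'rV[R]_n) (X T : set 'rV[R]_n).

Definition dot u v : R := \sum_i u 0 i * v 0 i.

(* The library norm `|u| on 'rV[R]_n is the sup norm, hence a separate
   Euclidean norm; both induce the topology of 'rV[R]_n. *)
Definition enorm u : R := Num.sqrt (dot u u).

Definition edist a X : R := inf [set enorm (a - x) | x in X].

Definition nearest X a : set 'rV[R]_n :=
  [set x | X x /\ enorm (a - x) = edist a X].

Definition medial_axis X : set 'rV[R]_n :=
  [set a | exists x y, [/\ nearest X a x, nearest X a y & x <> y]].

(* Orthogonal projection of x onto a + T; T is meant to be a linear subspace,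
   so that exactly one y qualifies. *)
Definition orth_proj a T x : 'rV[R]_n :=
  xget x [set y | T (y - a) /\ forall v, T v -> dot (x - y) v = 0].

End Euclidean.

(* f is of class C^k on the open set U. *)
Fixpoint is_Ck {R : realType} {p q : nat} (k : nat) (U : set 'rV[R]_p)
    (f : 'rV[R]_p -> 'rV[R]_q) : Prop :=
  (forall x, U x -> {for x, continuous f}) /\
  if k is k'.+1 then
    forall i : 'I_p,
      (forall x, U x -> derivable f x (delta_mx 0 i)) /\
      is_Ck k' U ('D_(delta_mx 0 i) f)
  else True.

Section Submanifolds.
Context {R : realType} {n : nat}.
Implicit Types (a v : 'rV[R]_n) (M U V X : set 'rV[R]_n).

Definition Ck_diffeo (k : nat) U V (phi psi : 'rV[R]_n -> 'rV[R]_n) : Prop :=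
  [/\ is_Ck k U phi, is_Ck k V psi,
      forall x, U x -> V (phi x) /\ psi (phi x) = x &
      forall y, V y -> U (psi y) /\ phi (psi y) = y].

(* R^d x {0} inside R^n *)
Definition coord_plane (d : nat) : set 'rV[R]_n :=
  [set y | forall i : 'I_n, (d <= i)%N -> y 0 i = 0].

Definition submanifold (k d : nat) M : Prop :=
  forall a, M a -> exists U V (phi psi : 'rV[R]_n -> 'rV[R]_n),
    [/\ open U, open V, U a, Ck_diffeo k U V phi psi &
        phi @` (M `&` U) = V `&` coord_plane d].

Definition Reg (k : nat) X : set 'rV[R]_n :=
  [set x | X x /\ exists U, nbhs x U /\
           exists d : nat, (d <= n)%N /\ submanifold k d (X `&` U)].

Definition Sng (k : nat) X : set 'rV[R]_n := X `\` Reg k X.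

(* Velocities at a of the curves in X through a; this is the tangent space
   T_a X when a is in Reg 1 X. *)
Definition tangent X a : set 'rV[R]_n :=
  [set v | exists gamma : R -> 'rV[R]_n,
     [/\ gamma 0 = a, \forall t \near 0, X (gamma t) &
         is_derive (0 : R) 1 gamma v]].

End Submanifolds.

(* The greatest element of A, with junk value 0 if there is none. *)
Definition set_max {R : realType} (A : set R) : R := xget 0 (A `&` ubound A).

Section Superquadracity.
Context {R : realType} {n : nat}.
Implicit Types (X : set 'rV[R]_n) (a : 'rV[R]_n) (r eps : R).

(* g(eps), for U the closed Euclidean ball of radius r centred at a *)
Definition bulge X a r eps : R :=
  let p := orth_proj a (tangent X a) in
  set_max [set enorm (x - p x) | x in
    [set x | [/\ X x, enorm (x - a) <= r & enorm (p x - a) = eps]]].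

Definition superquadratic X a : Prop :=
  \forall r \near (0 : R)^'+,
    bulge X a r eps / eps ^+ 2 @[eps --> (0 : R)^'+] --> +oo.

Definition SQ X : set 'rV[R]_n :=
  [set a | (Sng 2 X `&` Reg 1 X) a /\ superquadratic X a].

End Superquadracity.

(* Main.v *)
Require Import Defs.
From mathcomp Require Import all_boot all_order all_algebra.
From mathcomp Require Import all_classical all_reals all_analysis.
From mathcomp Require Import ring lra.
Import Order.TTheory GRing.Theory Num.Theory.
Import numFieldNormedType.Exports.
Local Open Scope classical_set_scope.
Local Open Scope ring_scope.
Set Implicit Arguments.
Unset Strict Implicit.
Unset Printing Implicit Defensive.

(* If 0 is not in the closure of the medial axis, then nearest points are unique
   on a ball around 0. Under this uniqueness the distance to X grows with unit
   speed away from the nearest point, so the maximum of the distance over the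
   ball B(a, t) is d(a) + t; strict convexity then forces the segment from the
   nearest point x through a to be prolonged by t without losing x as a nearest
   point. Every unit normal v to the tangent space at 0 is a limit of such
   directions (take a = tau v with tau -> 0), whence 2 t <v, y> <= |y|^2 for all
   y in X, with a uniform t > 0. Applied to the normal component of y this
   bounds the bulge g(eps) by O(eps^2), against superquadracity. *)

(** * Euclidean norm, its topology, and nearest points *)

Section EuclideanNorm.
Context {R : realType} {n : nat}.
Implicit Types (a c u v w x y z : 'rV[R]_n) (X : set 'rV[R]_n) (r s t e : R).

Lemma dotC u v : dot u v = dot v u.
Proof. by apply: eq_bigr => i _; rewrite mulrC. Qed.

Lemma dotDl u v w : dot (u + v) w = dot u w + dot v w.
Proof. by rewrite -big_split; apply: eq_bigr => i _; rewrite mxE mulrDl. Qed.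

Lemma dotZl s u v : dot (s *: u) v = s * dot u v.
Proof. by rewrite big_distrr; apply: eq_bigr => i _; rewrite mxE -mulrA. Qed.

Lemma dotNl u v : dot (- u) v = - dot u v.
Proof. by rewrite -scaleN1r dotZl mulN1r. Qed.

Lemma dotDr u v w : dot w (u + v) = dot w u + dot w v.
Proof. by rewrite dotC dotDl !(dotC w). Qed.

Lemma dotZr s u v : dot u (s *: v) = s * dot u v.
Proof. by rewrite dotC dotZl dotC. Qed.

Lemma dotNr u v : dot u (- v) = - dot u v.
Proof. by rewrite dotC dotNl dotC. Qed.

Definition dotE := (dotDl, dotDr, dotNl, dotNr, dotZl, dotZr).

Lemma dot_ge0 u : 0 <= dot u u.
Proof. by apply: sumr_ge0 => i _; rewrite -expr2 sqr_ge0. Qed.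

Lemma enorm_ge0 u : 0 <= enorm u.
Proof. exact: sqrtr_ge0. Qed.

Lemma enorm_sqr u : enorm u ^+ 2 = dot u u.
Proof. by rewrite sqr_sqrtr ?dot_ge0. Qed.

Lemma enorm_le u r : 0 <= r -> (enorm u <= r) = (dot u u <= r ^+ 2).
Proof. by move=> r0; rewrite -enorm_sqr ler_sqr ?nnegrE ?enorm_ge0. Qed.

Lemma enorm_ge u r : 0 <= r -> (r <= enorm u) = (r ^+ 2 <= dot u u).
Proof. by move=> r0; rewrite -enorm_sqr ler_sqr ?nnegrE ?enorm_ge0. Qed.

Lemma norm_entry u i : `|u 0 i| <= `|u|.
Proof. by rewrite [leRHS]/Num.Def.normr /= mx_normrE (le_bigmax _ _ (0, i)). Qed.

Lemma norm_le_enorm u : `|u| <= enorm u.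
Proof.
rewrite [leLHS]/Num.Def.normr /= mx_normrE bigmax_le ?enorm_ge0// => -[i j] _ /=.
rewrite (ord1 i) enorm_ge// real_normK ?num_real// /dot (bigD1 j)//= -expr2.
by rewrite lerDl; apply: sumr_ge0 => k _; rewrite -expr2 sqr_ge0.
Qed.

(** The crude factor [n.+1], in place of the square root of [n], stays positive for [n = 0], so one
    may divide by it. *)
Lemma enorm_le_norm u : enorm u <= n.+1%:R * `|u|.
Proof.
rewrite enorm_le ?mulr_ge0// exprMn.
apply: (@le_trans _ _ (\sum_(i < n) `|u| ^+ 2)).
  apply: ler_sum => i _; rewrite -expr2 -[u 0 i ^+ 2]real_normK ?num_real//.
  by rewrite ler_sqr ?nnegrE// norm_entry.
rewrite sumr_const card_ord -[leLHS]mulr_natl ler_wpM2r ?sqr_ge0// -natrX ler_nat.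
by rewrite (leq_trans (leqnSn n))// leq_pmulr.
Qed.

Lemma enorm_eq0 u : enorm u = 0 -> u = 0.
Proof.
by move=> u0; apply/eqP; rewrite -normr_le0 -u0 norm_le_enorm.
Qed.

Lemma enorm0 : enorm (0 : 'rV[R]_n) = 0.
Proof. by rewrite /enorm -(scale0r 0) dotZl mul0r sqrtr0. Qed.

Lemma enormN u : enorm (- u) = enorm u.
Proof. by rewrite /enorm dotNl dotNr opprK. Qed.

Lemma enormC u v : enorm (u - v) = enorm (v - u).
Proof. by rewrite -enormN opprB. Qed.

Lemma enormZ s u : enorm (s *: u) = `|s| * enorm u.
Proof.
by rewrite /enorm dotZl dotZr mulrA -expr2 sqrtrM ?sqr_ge0// sqrtr_sqr.
Qed.

Lemma dot_le u v : dot u v <= enorm u * enorm v.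
Proof.
have [/enorm_eq0->|u0] := eqVneq (enorm u) 0.
  by rewrite enorm0 mul0r -(scale0r 0) dotZl mul0r.
have up : 0 < enorm u by rewrite lt_neqAle eq_sym u0 enorm_ge0.
have := dot_ge0 (enorm u ^+ 2 *: v - dot u v *: u).
rewrite !dotE (dotC v u) -!enorm_sqr => h.
have h1 : 0 <= (enorm u * enorm v) ^+ 2 - dot u v ^+ 2.
  rewrite -(@pmulr_rge0 _ (enorm u ^+ 2)) ?exprn_gt0//.
  by apply: le_trans h _; rewrite le_eqVlt; apply/orP; left; apply/eqP; ring.
rewrite subr_ge0 in h1.
apply: le_trans (ler_norm _) _.
by rewrite -ler_sqr ?nnegrE ?mulr_ge0 ?enorm_ge0// real_normK ?num_real.
Qed.

Lemma enormD u v : enorm (u + v) <= enorm u + enorm v.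
Proof.
rewrite enorm_le ?addr_ge0 ?enorm_ge0// !dotE (dotC v u) -!enorm_sqr.
have := dot_le u v; nra.
Qed.

Lemma enorm_dist u v w : enorm (u - w) <= enorm (u - v) + enorm (v - w).
Proof. by rewrite -[u - w](subrKA v) enormD. Qed.

Lemma nbhs_enormP x (P : set 'rV[R]_n) :
  nbhs x P <-> exists2 e, 0 < e & forall z, enorm (z - x) < e -> P z.
Proof.
split=> [/(@nbhs_normP _ _ x P)[e /= e0 eP]|[e e0 eP]].
  exists e => // z zx; apply: eP => /=.
  by rewrite distrC; exact: le_lt_trans (norm_le_enorm _) _.
apply/(@nbhs_normP _ _ x P); exists (e / n.+1%:R) => /=; first by rewrite divr_gt0.
move=> z /=; rewrite distrC ltr_pdivlMr// mulrC => zx; apply: eP.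
exact: le_lt_trans (enorm_le_norm _) _.
Qed.

Lemma enorm_continuous a : continuous (fun z => enorm (z - a)).
Proof.
move=> x; apply/(@cvgrPdist_le _ _ _ (nbhs x)) => e e0.
apply/nbhs_enormP; exists e => // z zx.
have := enorm_dist x z a; have := enorm_dist z x a; rewrite (enormC x z).
by rewrite ler_norml; lra.
Qed.

Lemma compact_eball X a r : closed X -> compact (X `&` [set z | enorm (z - a) <= r]).
Proof.
move=> clX; apply: bounded_closed_compact.
  exists (r + enorm a); split; first exact: num_real.
  move=> M rM z [_ /= zr]; apply: le_trans (norm_le_enorm _) _.
  have := enorm_dist z a 0; rewrite !subr0; lra.
apply: closedI => //.
have -> : [set z | enorm (z - a) <= r] = (fun z => enorm (z - a)) @^-1` [set s | s <= r].
  by [].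
by apply: closed_comp => [x _|]; [exact: enorm_continuous|exact: closed_le].
Qed.

Lemma edist_le X a x : X x -> Defs.edist a X <= enorm (a - x).
Proof.
move=> Xx; apply: ge_inf; last by exists x.
by exists 0 => _ [z _ <-]; exact: enorm_ge0.
Qed.

Lemma nearestP X a x :
  nearest X a x <-> X x /\ forall y, X y -> enorm (a - x) <= enorm (a - y).
Proof.
split=> [[Xx ->]|[Xx xP]]; split=> //.
  by move=> y; exact: edist_le.
apply/eqP; rewrite eq_le edist_le// andbT; apply: lb_le_inf.
  by exists (enorm (a - x)); exists x.
by move=> _ [y Xy <-]; exact: xP.
Qed.

Lemma nearest_ex X a : closed X -> X !=set0 -> exists x, nearest X a x.
Proof.
move=> clX [x0 Xx0].
have cK := @compact_eball X a (enorm (x0 - a)) clX.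
have [||x] := @compact_EVT_min _ R (fun z => enorm (z - a)) _ _ cK.
- by exists x0; split => /=.
- by apply: continuous_subspaceT; exact: enorm_continuous.
rewrite inE => -[Xx /= xx0] xP; exists x; apply/nearestP; split=> // y Xy.
rewrite !(enormC a); have [yx0|/ltW yx0] := leP (enorm (y - a)) (enorm (x0 - a)).
  by apply: xP; rewrite inE.
exact: le_trans yx0.
Qed.

Lemma edist_Lip X a c : closed X -> X !=set0 ->
  Defs.edist c X <= Defs.edist a X + enorm (c - a).
Proof.
move=> clX /(nearest_ex a clX)[x [Xx <-]].
by have := edist_le c Xx; have := enorm_dist c a x; lra.
Qed.

(** By compactness: points of [X] that are [e]-far from [y] exceed the distance from [c] to [y] by a
    positive gap, since [y] is the only nearest point, and a small displacement of [c] cannot close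
    that gap. *)
Lemma nearest_continuous X c y e : closed X -> 0 < e -> nearest X c y ->
    (forall z, nearest X c z -> z = y) ->
  exists2 d, 0 < d & forall c' z, enorm (c' - c) <= d -> nearest X c' z ->
    enorm (z - y) < e.
Proof.
move=> clX e0 ncy uniq.
have /nearestP[Xy yP] := ncy.
(* The outer radius makes [K] compact; its margin 2 leaves room, by [far] below, for displacements
   of [c] up to 1. *)
pose K := (X `&` [set z | e <= enorm (z - y)]) `&`
  [set z | enorm (z - c) <= enorm (c - y) + 2].
have cK : compact K.
  apply: compact_eball; apply: closedI => //.
  have -> : [set z | e <= enorm (z - y)] = (fun z => enorm (z - y)) @^-1` [set s | e <= s].
    by [].
  by apply: closed_comp => [x _|]; [exact: enorm_continuous|exact: closed_ge].
have far c' z d : enorm (c' - c) <= d -> nearest X c' z ->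
    enorm (z - c) <= enorm (c - y) + 2 * d.
  move=> cd /nearestP[Xz /(_ y Xy)].
  have := enorm_dist z c' c; have := enorm_dist c' c y.
  rewrite (enormC z c'); lra.
have [[k0 Kk0]|K0] := pselect (K !=set0); last first.
  exists 1 => // c' z cd nz; rewrite ltNge; apply/negP => ez; apply: K0.
  exists z; split; first by split=> //; case: nz.
  by have := far _ _ _ cd nz; rewrite mulr1.
have [||k] := @compact_EVT_min _ R (fun z => enorm (z - c)) K _ cK.
- by exists k0.
- by apply: continuous_subspaceT; exact: enorm_continuous.
rewrite inE => -[[Xk /= ek] _] kP.
have dk : enorm (c - y) < enorm (k - c).
  rewrite (enormC k) ltNge; apply/negP => kle.
  have : nearest X c k.
    by apply/nearestP; split=> // z /yP; exact: le_trans.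
  by move=> /uniq ky; move: ek; rewrite ky subrr enorm0 leNgt e0.
have [kd|kd] := leP (enorm (k - c)) (enorm (c - y) + 2).
  (* By [far], a displacement of a third of the gap puts [z] at most two thirds of the gap beyond
     [enorm (c - y)], hence closer to [c] than the minimizer [k]. *)
  exists ((enorm (k - c) - enorm (c - y)) / 3); first by lra.
  move=> c' z cd nz; rewrite ltNge; apply/negP => ez.
  have := far _ _ _ cd nz => zc.
  have : enorm (k - c) <= enorm (z - c).
    by apply: kP; rewrite inE; split; [split => //; case: nz|rewrite /=; lra].
  lra.
exists 1 => // c' z cd nz; rewrite ltNge; apply/negP => ez.
have := far _ _ _ cd nz => zc.
have : enorm (k - c) <= enorm (z - c).
  by apply: kP; rewrite inE; split; [split => //; case: nz|rewrite /=; lra].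
lra.
Qed.

End EuclideanNorm.

(** * Growth of the distance and prolongation of normal segments *)

Section NearestPoints.
Context {R : realType} {n : nat}.
Implicit Types (a c u v w x y z : 'rV[R]_n) (X : set 'rV[R]_n) (r s t e : R).

Lemma edist_continuous X : closed X -> X !=set0 ->
  continuous (fun c => Defs.edist c X).
Proof.
move=> clX X0 x; apply/(@cvgrPdist_le _ _ _ (nbhs x)) => e e0.
apply/nbhs_enormP; exists e => // z zx.
have := edist_Lip x z clX X0; have := edist_Lip z x clX X0; rewrite (enormC x z).
by rewrite ler_norml; lra.
Qed.

(* At a point [c] with a unique nearest point [y], the distance to [X] grows
   with unit speed in the direction [c - y]; hence the penalized distance
   cannot have an interior maximum. *)
Lemma edist_growth X a x t e : closed X -> 0 <= t -> 0 < e < 1 ->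
    nearest X a x -> 0 < enorm (a - x) ->
    (forall c y z, enorm (c - a) <= t ->
       nearest X c y -> nearest X c z -> y = z) ->
  exists2 c, enorm (c - a) <= t &
    enorm (a - x) + (1 - e) * t <= Defs.edist c X.
Proof.
move=> clX t0 /andP[e0 e1] [Xx ax] s0 uniq.
have X0 : X !=set0 by exists x.
pose f z := Defs.edist z X - (1 - e) * enorm (z - a).
have cK := @compact_eball _ _ setT a t closedT.
have [||c] := @compact_EVT_max _ R f _ _ cK.
- by exists a; split => //=; rewrite subrr enorm0.
- apply: continuous_subspaceT => z; apply: (@cvgB _ _ _ (nbhs z)).
    exact: edist_continuous.
  by apply: (@cvgM _ _ (nbhs z)); [exact: cvg_cst|exact: enorm_continuous].
rewrite inE => -[_ /= ca] cP.
have fac : enorm (a - x) <= f c.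
  have : f a <= f c by apply: cP; rewrite inE /=; split => //=; rewrite subrr enorm0.
  by rewrite {1}/f subrr enorm0 mulr0 subr0 ax.
exists c => //.
(* A maximum on the boundary sphere gives the claim; the rest excludes an interior one. *)
have [tc|ct] := leP t (enorm (c - a)).
  have <- : enorm (c - a) = t by apply/eqP; rewrite eq_le ca.
  by move: fac; rewrite /f; lra.
exfalso.
have [y ncy] := nearest_ex c clX X0.
have := ncy.2; set D := enorm (c - y) => cy.
have D0 : 0 < D.
  have : 0 <= (1 - e) * enorm (c - a) by rewrite mulr_ge0 ?enorm_ge0//; lra.
  by rewrite cy; move: fac s0; rewrite /f; lra.
(* If the nearest point moves by less than [e * D / 4], the squared distance at [c'] is at least [D
   ^+ 2 + 2 * h * D * (1 - e / 4) + h ^+ 2]. This exceeds [(D + (1 - e) * h) ^+ 2], the bound that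
   maximality of [f c] imposes. *)
have eD0 : 0 < e * D / 4 by rewrite divr_gt0// mulr_gt0.
have [|d d0 dP] := nearest_continuous clX eD0 ncy.
  by move=> z ncz; apply: (uniq c).
pose h := Num.min d (t - enorm (c - a)).
have h0 : 0 < h by rewrite lt_min d0 subr_gt0.
have hd : h <= d by rewrite ge_min lexx.
have ht : h <= t - enorm (c - a) by rewrite ge_min lexx orbT.
have [w w1 wcy] : exists2 w, enorm w = 1 & dot w (c - y) = D.
  exists (D^-1 *: (c - y)).
    by rewrite enormZ ger0_norm ?invr_ge0 ?ltW// mulVf// gt_eqF.
  by rewrite dotZl -enorm_sqr -/D expr2 mulKf// gt_eqF.
pose c' := c + h *: w.
have c'c : enorm (c' - c) = h by rewrite /c' addrC addKr enormZ w1 mulr1 gtr0_norm.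
have c'a : enorm (c' - a) <= enorm (c - a) + h.
  by have := enorm_dist c' c a; rewrite c'c; lra.
have [z nz] := nearest_ex c' clX X0.
have zy : enorm (z - y) < e * D / 4 by apply: dP nz; rewrite c'c.
have fc' : f c' <= f c by apply: cP; rewrite inE /=; split => //=; lra.
have : enorm (c' - z) <= D + (1 - e) * h.
  have : (1 - e) * (enorm (c - a) + h - enorm (c' - a)) >= 0 by rewrite mulr_ge0//; lra.
  by move: fc'; rewrite /f nz.2 cy; lra.
have e10 : 0 <= (1 - e) * h by rewrite mulr_ge0//; lra.
rewrite enorm_le; last by lra.
have -> : c' - z = (c - z) + h *: w by rewrite /c' addrAC.
have -> : dot (c - z + h *: w) (c - z + h *: w) =
    dot (c - z) (c - z) + 2 * h * dot w (c - z) + h ^+ 2 * dot w w.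
  by move: (c - z) => p; rewrite !dotE (dotC p w); ring.
rewrite -!enorm_sqr w1.
have -> : dot w (c - z) = D - dot w (z - y).
  by rewrite -wcy !dotE; ring.
have := dot_le w (z - y); rewrite w1 mul1r => wzy.
have : D ^+ 2 <= enorm (c - z) ^+ 2.
  rewrite ler_sqr ?nnegrE ?enorm_ge0//; first by rewrite cy edist_le//; case: nz.
have : 0 <= h * (e * D / 4 - dot w (z - y)) by rewrite mulr_ge0; lra.
have : 0 < e * h * D by rewrite !mulr_gt0.
have : 0 <= h ^+ 2 - ((1 - e) * h) ^+ 2.
  rewrite subr_ge0 ler_sqr ?nnegrE//; first by nra.
  exact: ltW.
nra.
Qed.

(** Letting [e] tend to 0 in [edist_growth], some [c] in the ball is at distance at least
    [enorm (a - x) + t] from [X]. As [x] lies in [X], the triangle inequality through [a] is then an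
    equality, and strict convexity puts [c] on the ray from [x] through [a]. *)
Lemma nearest_extend X a x t : closed X -> 0 <= t ->
    nearest X a x -> 0 < enorm (a - x) ->
    (forall c y z, enorm (c - a) <= t ->
       nearest X c y -> nearest X c z -> y = z) ->
  nearest X (a + (t / enorm (a - x)) *: (a - x)) x.
Proof.
move=> clX t0 nax s0 uniq; have [Xx ax] := nax.
have X0 : X !=set0 by exists x.
have cK := @compact_eball _ _ setT a t closedT.
have [||c] := @compact_EVT_max _ R (fun z => Defs.edist z X) _ _ cK.
- by exists a; split => //=; rewrite subrr enorm0.
- by apply: continuous_subspaceT; exact: edist_continuous.
rewrite inE => -[_ /= ca] cP.
set s := enorm (a - x).
have dc : s + t <= Defs.edist c X.
  apply/ler_addgt0Pr => e e0.
  (* Chosen so that [e' * t <= e]; the [+ 1] covers [t = 0]. *)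
  pose e' := Num.min (e / (t + 1)) (1 / 2).
  have t1 : 0 < t + 1 by lra.
  have et0 : 0 < e / (t + 1) by rewrite divr_gt0.
  have e'1 : 0 < e' < 1 by rewrite lt_min gt_min et0; apply/andP; split => //; lra.
  have [c' c'a c'P] := edist_growth clX t0 e'1 nax s0 uniq.
  have : Defs.edist c' X <= Defs.edist c X by apply: cP; rewrite inE.
  have : e' * t <= e.
    apply: (@le_trans _ _ (e / (t + 1) * t)).
      by rewrite ler_wpM2r// ge_min lexx.
    by rewrite mulrAC ler_pdivrMr//; nra.
  by move: c'P; rewrite -/s; lra.
have [u u1 axu] : exists2 u, enorm u = 1 & a - x = s *: u.
  exists (s^-1 *: (a - x)); last by rewrite scalerA mulfV ?scale1r// gt_eqF.
  by rewrite enormZ ger0_norm ?invr_ge0 ?ltW// mulVf// gt_eqF.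
have stc : s + t <= enorm ((c - a) + s *: u).
  by rewrite -axu addrA subrK; apply: le_trans dc (edist_le _ _).
have cau : c - a = t *: u.
  apply/eqP; rewrite -subr_eq0; apply/eqP/enorm_eq0/eqP.
  rewrite eq_le enorm_ge0 andbT enorm_le// expr0n /=.
  (* For [b = c - a], the two squared bounds and [0 < s] give [t <= dot b u], so the square of
     [enorm (b - t *: u)] is at most [t ^+ 2 - 2 * t * t + t ^+ 2 = 0]. *)
  move: stc ca; rewrite enorm_ge ?addr_ge0 ?enorm_ge0// enorm_le//.
  move: (c - a) => b; rewrite !dotE (dotC u b) -(enorm_sqr u) u1 => h1 h2.
  have : 0 <= s * (dot b u - t) by nra.
  rewrite pmulr_rge0// => /(mulr_ge0 t0); lra.
have -> : a + (t / s) *: (a - x) = c.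
  by rewrite axu scalerA divfK ?gt_eqF// -cau addrC subrK.
split=> //; apply/eqP; rewrite eq_le edist_le// andbT.
apply: le_trans dc; rewrite -[c](subrK a) cau -addrA axu -scalerDl enormZ u1 mulr1.
by rewrite ger0_norm ?addr_ge0 ?enorm_ge0// addrC.
Qed.

End NearestPoints.

(** * Balls tangent at the origin that avoid the set *)

Section NormalBall.
Context {R : realType} {n : nat}.
Implicit Types (a c u v w x y z : 'rV[R]_n) (X : set 'rV[R]_n) (r s t e : R).

(* [w] is the proximal normal at the point [x] of [X] nearest to [tau *: v],
   for [tau] small. *)
Lemma proximal_normal_approx X v t e : closed X -> X 0 -> enorm v = 1 -> 0 < t ->
    (forall e, 0 < e -> exists2 d, 0 < d & forall x, X x -> enorm x <= d ->
       dot v x <= e * enorm x) ->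
    (forall c y z, enorm c <= 2 * t ->
       nearest X c y -> nearest X c z -> y = z) ->
    0 < e < 1 ->
  exists x w, [/\ enorm x <= e, enorm (w - v) <= e &
    forall y, X y -> 2 * t * dot w (y - x) <= enorm (y - x) ^+ 2].
Proof.
move=> clX X0 v1 t0 flat uniq /andP[e0 e1].
have [|d d0 dP] := flat (e ^+ 2 / 4); first by rewrite divr_gt0// exprn_gt0.
(* The bound [d / 2] brings [x], of norm at most [2 * tau], within reach of [dP]; [1 / 2] turns
   [e * tau] into at most [e]; [t] keeps the [t]-ball about [tau *: v] in the [2 * t]-ball about
   0. *)
pose tau := Num.min (d / 2) (Num.min (1 / 2) t).
have tau0 : 0 < tau by rewrite !lt_min t0 andbT; apply/andP; split; lra.
have taud : tau <= d / 2 by rewrite ge_min lexx.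
have tau1 : tau <= 1 / 2 by rewrite !ge_min lexx orbT.
have taut : tau <= t by rewrite !ge_min lexx !orbT.
have av : enorm (tau *: v) = tau by rewrite enormZ v1 mulr1 gtr0_norm.
set a := tau *: v in av.
have [x nax] : exists x, nearest X a x by apply: nearest_ex => //; exists 0.
have /nearestP[Xx /(_ 0 X0)] := nax; rewrite subr0 av => ax.
have x2 : enorm x <= 2 * tau.
  have := enorm_dist 0 a x; rewrite !sub0r !enormN av; lra.
have vx : dot v x <= e ^+ 2 / 4 * enorm x by apply: dP => //; lra.
(* Since [x] is at least as close to [a] as 0 is, [enorm x ^+ 2 <= 2 * tau * dot v x]. Flatness with
   [e ^+ 2 / 4] and [enorm x <= 2 * tau] bound this by [(e * tau) ^+ 2]. *)
have ex : enorm x <= e * tau.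
  have e20 : 0 <= e ^+ 2 / 4 by rewrite divr_ge0// sqr_ge0.
  have := ler_wpM2l e20 x2 => h1.
  have h2 : tau * dot v x <= tau * (e ^+ 2 / 4 * (2 * tau)).
    by apply: ler_wpM2l; [exact: ltW|exact: le_trans vx h1].
  move: ax; rewrite enorm_le ?(ltW tau0)// enorm_le; last by apply: mulr_ge0; exact: ltW.
  rewrite /a !dotE (dotC x v) -(enorm_sqr v) v1; nra.
have s0 : 0 < enorm (a - x).
  have : e * tau < tau by rewrite gtr_pMl.
  have := enorm_dist a x 0; rewrite !subr0 av; lra.
have unqa c y z : enorm (c - a) <= t -> nearest X c y -> nearest X c z -> y = z.
  move=> ca; apply: uniq; have := enorm_dist c a 0; rewrite !subr0 av; lra.
have := nearest_extend clX (ltW t0) nax s0 unqa.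
set s := enorm (a - x) in ax s0 *.
move=> /nearestP[_ far].
(* Scaling by [tau^-1] instead of normalizing makes [w - v] equal to [- (tau^-1 *: x)]. *)
exists x, (tau^-1 *: (a - x)); split.
- by apply: le_trans ex _; rewrite ger_pMr//; lra.
- have -> : tau^-1 *: (a - x) - v = - (tau^-1 *: x).
    by rewrite /a scalerBr scalerA mulVf ?gt_eqF// scale1r addrAC subrr add0r.
  by rewrite enormN enormZ gtr0_norm ?invr_gt0// mulrC ler_pdivrMr.
move=> y Xy; rewrite dotZl.
have := far y Xy; rewrite -ler_sqr ?nnegrE ?enorm_ge0// !enorm_sqr.
have -> : a + (t / s) *: (a - x) - y =
    (a + (t / s) *: (a - x) - x) - (y - x) by rewrite opprB addrA subrK.
have -> : a + (t / s) *: (a - x) - x = (1 + t / s) *: (a - x).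
  by rewrite scalerDl scale1r addrAC.
move: (y - x) => z; move: (a - x) => b.
rewrite !dotE (dotC z b) => h.
have {}h : 2 * (1 + t / s) * dot b z <= dot z z by lra.
(* A negative product is harmless; otherwise [s <= tau] gives [t / tau <= t / s]. *)
have [bz|bz] := leP 0 (dot b z); last first.
  apply: le_trans (dot_ge0 z); apply: mulr_ge0_le0; first lra.
  by apply: mulr_ge0_le0; rewrite ?invr_ge0; exact: ltW.
apply: le_trans h; rewrite mulrA ler_wpM2r// -mulrA ler_wpM2l//.
rewrite ler_pdivrMr//.
have : tau / s >= 1 by rewrite ler_pdivlMr ?mul1r.
move=> /(ler_wpM2l (ltW t0)).
have -> : t * (tau / s) = t / s * tau by ring.
lra.
Qed.

(** This is the limit [e -> 0] of [proximal_normal_approx]. Geometrically, the open ball of radius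
    [t] centred at [t *: v] misses [X]. *)
Lemma normal_ball X v t y : closed X -> X 0 -> enorm v = 1 -> 0 < t ->
    (forall e, 0 < e -> exists2 d, 0 < d & forall x, X x -> enorm x <= d ->
       dot v x <= e * enorm x) ->
    (forall c y z, enorm c <= 2 * t ->
       nearest X c y -> nearest X c z -> y = z) ->
  X y -> 2 * t * dot v y <= enorm y ^+ 2.
Proof.
move=> clX X0 v1 t0 flat uniq Xy; apply/ler_addgt0Pr => e e0.
set Y := enorm y; have Y0 : 0 <= Y := enorm_ge0 y.
(* The total coefficient of [e'] in the error terms, once [e' ^+ 2] is bounded by [e']. *)
pose C := 2 * t * (2 + Y) + 2 * Y + 1.
have C0 : 0 < C by rewrite /C; nra.
pose e' := Num.min (e / C) (1 / 2).
have e'1 : 0 < e' < 1.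
  by rewrite lt_min gt_min divr_gt0//; apply/andP; split; lra.
have e'C : e' * C <= e.
  by rewrite -ler_pdivlMr// ge_min lexx.
have [x [w [xe wv /(_ y Xy)]]] := proximal_normal_approx clX X0 v1 t0 flat uniq e'1.
have /andP[e'0 {}e'1] := e'1.
have yx : enorm (y - x) <= Y + e'.
  by have := enorm_dist y 0 x; rewrite subr0 sub0r enormN -/Y; lra.
have -> : dot w (y - x) = dot v y - dot v x + dot (w - v) (y - x).
  by rewrite !dotE; ring.
have vx : dot v x <= e'.
  by have := dot_le v x; rewrite v1 mul1r; lra.
have wvyx : dot (v - w) (y - x) <= e' * (Y + e').
  apply: le_trans (dot_le _ _) _; rewrite enormC.
  by apply: ler_pM => //; exact: enorm_ge0.
have -> : dot (w - v) (y - x) = - dot (v - w) (y - x) by rewrite -dotNl opprB.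
have yx2 : enorm (y - x) ^+ 2 <= (Y + e') ^+ 2.
  by rewrite ler_sqr ?nnegrE ?enorm_ge0//; lra.
move=> h.
have : t * (dot v x + dot (v - w) (y - x)) <= t * (e' + e' * (Y + e')).
  by apply: ler_wpM2l; [exact: ltW|lra].
have e'2 : e' ^+ 2 <= e' by rewrite expr2 ger_pMr// ltW.
have := ler_wpM2l (ltW t0) e'2.
move: e'C; rewrite /C; nra.
Qed.

End NormalBall.

(** * First-order expansion of maps of class C^1 *)

Section FirstOrderExpansion.
Context {R : realType}.

Lemma mx_norm_le n (u : 'rV[R]_n) r :
  0 <= r -> (forall i, `|u 0 i| <= r) -> `|u| <= r.
Proof.
move=> r0 ur; rewrite [leLHS]/Num.Def.normr /= mx_normrE bigmax_le// => -[i j] _ /=.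
by rewrite (ord1 i).
Qed.

Lemma is_derive_line (V W : normedModType R) (f : V -> W) x v (c : R) :
  derivable f (x + c *: v) v ->
  is_derive c 1 (fun t : R => f (x + t *: v)) ('D_v f (x + c *: v)).
Proof.
move=> df.
have E : (fun h : R => h^-1 *: (((fun t : R => f (x + t *: v)) \o shift c) (h *: 1)
      - f (x + c *: v))) =
    (fun h => h^-1 *: ((f \o shift (x + c *: v)) (h *: v) - f (x + c *: v))).
  apply: funext => h /=; congr (_ *: (f _ - _)).
  by rewrite -[h *: 1]/(h * 1) mulr1 scalerDl addrCA.
by apply: DeriveDef; rewrite /derivable /derive E.
Qed.

(** Both signs of [s] are covered because [C1_approx] applies this to coordinate increments of
    arbitrary sign. *)
Lemma MVT_sym (g dg : R -> R) (s : R) :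
  (forall c : R, `|c| <= `|s| -> is_derive c 1 g (dg c)) ->
  exists2 c, `|c| <= `|s| & g s - g 0 = dg c * s.
Proof.
move=> gd.
have cont a b : (forall c, c \in `[a, b] -> `|c| <= `|s|) -> {within `[a, b], continuous g}.
  move=> ab; apply: derivable_within_continuous => c /ab cs.
  by have [] := gd c cs.
have [s0|s0] := leP 0 s.
  have b c : c \in `[0, s] -> `|c| <= `|s|.
    by rewrite in_itv /= => /andP[c0 cs]; rewrite !ger0_norm.
  have [|c /b cs E] := @MVT_segment _ g dg _ _ s0 _ (cont _ _ b).
    by move=> c cs; apply: gd; apply: b; exact: subset_itv_oo_cc.
  by exists c => //; rewrite E subr0.
have b c : c \in `[s, 0] -> `|c| <= `|s|.
  by rewrite in_itv /= => /andP[c0 cs]; rewrite !ler0_norm ?lerN2// ltW.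
have [|c /b cs E] := @MVT_segment _ g dg _ _ (ltW s0) _ (cont _ _ b).
  by move=> c cs; apply: gd; apply: b; exact: subset_itv_oo_cc.
by exists c => //; rewrite -opprB E; ring.
Qed.

Context {p q : nat}.
Implicit Types (U : set 'rV[R]_p) (f : 'rV[R]_p -> 'rV[R]_q) (a h : 'rV[R]_p).

(** The differential of [f] at [a], assembled from the partial derivatives that [is_Ck] controls. *)
Definition gradient_map f a h : 'rV[R]_q :=
  \sum_i h 0 i *: 'D_(delta_mx 0 i) f a.

(** Moving one coordinate at a time, the mean value theorem yields a partial derivative at a nearby
    point, which continuity compares with its value at [a]. *)
Lemma C1_approx U f a e : open U -> is_Ck 1 U f -> U a -> 0 < e ->
  exists2 d, 0 < d & forall h, `|h| < d ->
    `|f (a + h) - f a - gradient_map f a h| <= e * `|h|.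
Proof.
move=> oU [_ f1] Ua e0.
(* Each of the [p] coordinate moves costs [e'] times the norm of [h]; [p.+1] avoids a zero
   divisor. *)
pose e' := e / p.+1%:R.
have e'0 : 0 < e' by rewrite divr_gt0.
have : \forall x \near a, U x /\
    forall i, `|'D_(delta_mx 0 i) f a - 'D_(delta_mx 0 i) f x| <= e'.
  apply: (@filterI _ (nbhs a)); first exact: open_nbhs_nbhs.
  apply: (@filter_forall _ _ _ (nbhs a)) => i; have [_ [Df _]] := f1 i.
  exact: (@cvgr_dist_le _ _ _ (nbhs a) _ ('D_(delta_mx 0 i) f) _ (Df a Ua)).
move=> /(@nbhs_normP _ _ a)[d /= d0 dP]; exists d => // h hd.
(* The points [a + hk k] lead from [a] to [a + h], so the increments of [f] along them telescope. *)
pose hk k : 'rV[R]_p := \row_i (if (i < k)%N then h 0 i else 0).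
have step (i : 'I_p) j :
    `|f (a + hk i.+1) 0 j - f (a + hk i) 0 j - h 0 i * 'D_(delta_mx 0 i) f a 0 j|
      <= e' * `|h|.
  pose F y : R := f y 0 j.
  have near_a c : `|c| <= `|h 0 i| -> ball_ Num.Def.normr a d (a + hk i + c *: delta_mx 0 i).
    move=> ch; rewrite /ball_ /= -addrA opprD addrA subrr add0r normrN.
    apply: le_lt_trans hd; apply: mx_norm_le => // k; rewrite !mxE eqxx /=.
    have [->|ki] := eqVneq k i.
      by rewrite ltnn mulr1 add0r; apply: le_trans ch (norm_entry _ _).
    rewrite mulr0 addr0; case: ifP => _; first exact: norm_entry.
    by rewrite normr0.
  have hkS : hk i.+1 = hk i + h 0 i *: delta_mx 0 i.
    apply/rowP => k; rewrite !mxE eqxx /= ltnS leq_eqVlt.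
    have [->|ki] := eqVneq k i; first by rewrite eqxx ltnn /= mulr1 add0r.
    by rewrite (negbTE (_ : nat_of_ord k != i)) //= mulr0 addr0.
  have derF y : U y -> derivable f y (delta_mx 0 i) /\
      derivable F y (delta_mx 0 i) /\
      'D_(delta_mx 0 i) F y = 'D_(delta_mx 0 i) f y 0 j.
    move=> Uy; have [dfi _] := f1 i; have dy := dfi y Uy.
    have /derivable_mxP/(_ 0 j) dyj := dy.
    by split=> //; split=> //; rewrite (derive_mx dy) mxE.
  have [c|c ch] := @MVT_sym (fun t => F (a + hk i + t *: delta_mx 0 i))
      (fun t => 'D_(delta_mx 0 i) F (a + hk i + t *: delta_mx 0 i)) (h 0 i).
    move=> /near_a/dP[Uc _]; apply: is_derive_line.
    by have [_ []] := derF _ Uc.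
  have [Uc /(_ i) Dc] := dP _ (near_a c ch).
  rewrite scale0r addr0 -addrA -hkS {1 2}/F => ->.
  have [_ [_ ->]] := derF _ Uc.
  rewrite (mulrC (h 0 i)) -mulrBl normrM ler_pM ?norm_entry//.
  apply: le_trans Dc; rewrite distrC; apply: le_trans (norm_entry _ j).
  by rewrite !mxE.
apply: mx_norm_le; first by rewrite mulr_ge0// ltW.
move=> j.
have -> : (f (a + h) - f a - gradient_map f a h) 0 j =
    \sum_(i < p) (f (a + hk i.+1) 0 j - f (a + hk i) 0 j
      - h 0 i * 'D_(delta_mx 0 i) f a 0 j).
  rewrite sumrB -(big_mkord xpredT (fun i => f (a + hk i.+1) 0 j - f (a + hk i) 0 j)).
  rewrite telescope_sumr// !mxE summxE.
  have -> : hk p = h by apply/rowP => k; rewrite mxE ltn_ord.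
  have -> : hk 0%N = 0 by apply/rowP => k; rewrite !mxE.
  by rewrite addr0; congr (_ - _); apply: eq_bigr => k _; rewrite !mxE.
apply: le_trans (ler_norm_sum _ _ _) _.
apply: (@le_trans _ _ (\sum_(i < p) (e' * `|h|))); first exact: ler_sum.
rewrite sumr_const card_ord -mulrnAl ler_wpM2r// -mulr_natr /e' mulrAC.
by rewrite ler_pdivrMr// ler_wpM2l ?ler_nat// ltW.
Qed.

Lemma C1_Lipschitz U f a : open U -> is_Ck 1 U f -> U a ->
  exists K d, [/\ 0 < K, 0 < d & forall h, `|h| < d -> `|f (a + h) - f a| <= K * `|h|].
Proof.
move=> oU f1 Ua; have [d d0 dP] := C1_approx oU f1 Ua ltr01.
exists (1 + \sum_i `|'D_(delta_mx 0 i) f a|), d; split=> //.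
  by rewrite ltr_wpDr// sumr_ge0.
move=> h /dP; rewrite mul1r => hP; rewrite mulrDl mul1r.
rewrite -[f _ - f a](subrK (gradient_map f a h)).
apply: le_trans (ler_normD _ _) _; apply: lerD => //.
apply: le_trans (ler_norm_sum _ _ _) _; rewrite mulr_suml; apply: ler_sum => i _.
by rewrite normrZ mulrC ler_wpM2l// norm_entry.
Qed.

Lemma is_derive_C1_line U f a w : open U -> is_Ck 1 U f -> U a ->
  is_derive (0 : R) 1 (fun t : R => f (a + t *: w)) (gradient_map f a w).
Proof.
move=> oU f1 Ua.
have cv : (fun h : R => h^-1 *: (((fun t : R => f (a + t *: w)) \o shift 0) (h *: 1)
    - f (a + 0 *: w))) @ 0^' --> gradient_map f a w.
  apply/cvgrPdist_le => /= e e0.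
  have ew : 0 < e / (`|w| + 1) by rewrite divr_gt0// ltr_wpDl.
  have [d d0 dP] := C1_approx oU f1 Ua ew.
  have dw : 0 < d / (`|w| + 1) by rewrite divr_gt0// ltr_wpDl.
  near=> t.
  have t0 : t != 0 by near: t; exact: nbhs_dnbhs_neq.
  have td : `|t| < d / (`|w| + 1) by near: t; exact: dnbhs0_lt.
  have tw : `|t *: w| < d.
    rewrite normrZ; move: td; rewrite ltr_pdivlMr ?ltr_wpDl//; apply: le_lt_trans.
    by rewrite ler_wpM2l// lerDl.
  have := dP _ tw.
  have -> : gradient_map f a (t *: w) = t *: gradient_map f a w.
    by rewrite scaler_sumr; apply: eq_bigr => i _; rewrite mxE scalerA.
  rewrite scale0r !addr0 -[t *: 1]/(t * 1) mulr1 => h.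
  rewrite -(scalerK t0 (gradient_map f a w)) -scalerBr normrZ normfV distrC.
  rewrite mulrC ler_pdivrMr ?normr_gt0//; apply: le_trans h _.
  rewrite normrZ mulrCA mulrC ler_wpM2r// mulrAC ler_pdivrMr ?ltr_wpDl//.
  by rewrite ler_wpM2l ?lerDl// ltW.
by apply: DeriveDef; [apply/cvg_ex; exists (gradient_map f a w)|exact: cvg_lim].
Unshelve. all: by end_near. Qed.

End FirstOrderExpansion.

(** In a straightening chart, [x = psi (b + w)] with [w] in the coordinate plane. The tangent vector
    [gradient_map psi b w] approximates [x - a] up to a small multiple of the norm of [w], and the
    Lipschitz bound on [phi] controls [w] by [x - a]. *)
Lemma tangent_flat (R : realType) (n : nat) (X : set 'rV[R]_n) a e :
    Reg 1 X a -> 0 < e ->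
  exists2 d, 0 < d & forall x, X x -> enorm (x - a) <= d ->
    exists2 v, tangent X a v & enorm (x - a - v) <= e * enorm (x - a).
Proof.
move=> [Xa [U [Ua [k [_ subm]]]]] e0.
have [|U' [V [phi [psi [oU' oV U'a [phi1 psi1 phiK psiK] phiX]]]]] := subm a.
  by split=> //; exact: nbhs_singleton.
have [Vq psiq] := phiK a U'a; set b := phi a in Vq psiq.
have plane x : X x -> U x -> U' x -> coord_plane k (phi x).
  move=> Xx Ux U'x; have : (phi @` ((X `&` U) `&` U')) (phi x) by exists x.
  by rewrite phiX => -[].
have chart y : V y -> coord_plane k y -> X (psi y).
  move=> Vy ky; have : (V `&` coord_plane k) y by [].
  by rewrite -phiX => -[x [[Xx _] U'x] <-]; rewrite (phiK x U'x).2.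
have kb : coord_plane k b by apply: plane => //; exact: nbhs_singleton.
(* Lines in the coordinate plane are carried by [psi] to curves in [X], whose velocities are
   tangent. *)
have tan w : coord_plane k w -> tangent X a (gradient_map psi b w).
  move=> kw; exists (fun t => psi (b + t *: w)); split.
  - by rewrite scale0r addr0.
  - have : \forall t \near (0 : R), V (b + t *: w).
      have cvb : (b + t *: w) @[t --> (0 : R)] --> b.
        rewrite -[X in _ --> X]addr0 -(scale0r w).
        by apply: cvgD; [exact: cvg_cst|apply: cvgZl; exact: cvg_id].
      by apply: cvb; exact: open_nbhs_nbhs.
    apply: filterS => t Vt; apply: chart => // i ki.
    by rewrite !mxE kb// kw// mulr0 addr0.
  - exact: is_derive_C1_line psi1 Vq.
have [K [d1 [K0 d10 lip]]] := C1_Lipschitz oU' phi1 U'a.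
(* [K] pays for passing from [w] to [x - a], and [n.+1] for passing from the sup norm to the
   Euclidean one. *)
have e'0 : 0 < e / (n.+1%:R * K) by rewrite divr_gt0// mulr_gt0.
have [d2 d20 expand] := C1_approx oV psi1 Vq e'0.
have /nbhs_enormP[d3 d30 d3P] : nbhs a (U `&` U').
  by apply: (@filterI _ (nbhs a)) => //; exact: open_nbhs_nbhs.
pose d := Num.min (d1 / 2) (Num.min (d2 / (2 * K)) (d3 / 2)).
exists d; first by rewrite !lt_min !divr_gt0// mulr_gt0.
move=> x Xx xd.
have xd1 : enorm (x - a) < d1.
  by apply: le_lt_trans xd _; rewrite !gt_min; apply/orP; left; lra.
have xd2 : K * enorm (x - a) < d2.
  have : enorm (x - a) <= d2 / (2 * K).
    by apply: le_trans xd _; rewrite !ge_min lexx orbT.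
  by rewrite ler_pdivlMr ?mulr_gt0//; nra.
have xd3 : enorm (x - a) < d3.
  by apply: le_lt_trans xd _; rewrite !gt_min; apply/orP; right; apply/orP; right; lra.
have [Ux U'x] := d3P x xd3.
pose w := phi x - b.
have kw : coord_plane k w.
  by move=> i ki; rewrite !mxE (kb i ki) (plane x Xx Ux U'x i ki) subrr.
have wx : `|w| <= K * enorm (x - a).
  have := lip (x - a); rewrite (addrC a) subrK => lipx.
  apply: le_trans (lipx _) _; first exact: le_lt_trans (norm_le_enorm _) _.
  by rewrite ler_wpM2l ?norm_le_enorm// ltW.
exists (gradient_map psi b w); first exact: tan.
have := expand w (le_lt_trans wx xd2).
have -> : b + w = phi x by rewrite addrC subrK.
rewrite (phiK x U'x).2 psiq => h.
apply: le_trans (enorm_le_norm _) _.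
apply: le_trans (ler_wpM2l _ h) _ => //.
have -> : n.+1%:R * (e / (n.+1%:R * K) * `|w|) = e * (`|w| / K).
  by field; rewrite gt_eqF//= pnatr_eq0.
by apply: ler_wpM2l; [exact: ltW|rewrite ler_pdivrMr// mulrC].
Qed.

(** * Points realizing the bulge *)

Section Bulge.
Context {R : realType} {n : nat}.
Implicit Types (X T : set 'rV[R]_n) (a x v : 'rV[R]_n).

(** The default of [xget] in [orth_proj] is [x] itself, so any other value comes from the defining
    set. *)
Lemma orth_projP a T x : orth_proj a T x <> x ->
  T (orth_proj a T x - a) /\ forall v, T v -> dot (x - orth_proj a T x) v = 0.
Proof. by rewrite /orth_proj; case: xgetP => // y _ yP. Qed.

(** The default of [set_max] is 0, so a positive value is an attained maximum. *)
Lemma bulge_gt0 X a r eps : 0 < bulge X a r eps -> exists x,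
  [/\ X x, enorm (x - a) <= r, enorm (orth_proj a (tangent X a) x - a) = eps &
      enorm (x - orth_proj a (tangent X a) x) = bulge X a r eps].
Proof.
rewrite /bulge /set_max; case: xgetP => [_ -> [[x [Xx xr xe] <-] _] _|_].
  by exists x.
by rewrite ltxx.
Qed.

End Bulge.

(** * Superquadracity against the tangent ball *)

Lemma not_closure_medial_axis (R : realType) (n : nat) (X : set 'rV[R]_n) a :
    ~ closure (medial_axis X) a ->
  exists2 r, 0 < r & forall c y z, enorm (c - a) < r ->
    nearest X c y -> nearest X c z -> y = z.
Proof.
move=> nM; have /nbhs_enormP[r r0 rP] : nbhs a (~` medial_axis X).
  apply: contrapT => nb; apply: nM => B Ba; apply/set0P/negP => /eqP MB.
  apply: nb; apply: filterS Ba => z Bz Mz.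
  by have : (medial_axis X `&` B) z by []; rewrite MB.
exists r => // c y z /rP nMc cy cz; apply: contrapT => yz; apply: nMc.
by exists y, z.
Qed.

Unset Implicit Arguments.

Theorem theorem3p7 (R : realType) (S : ominimal R) (n : nat)
  (X : set 'rV[R]_n) (closedX : closed X) (definableX : definable S X)
  (X0 : (Sng 2 X `&` Reg 1 X) 0) (SQX0 : SQ X 0) :
  closure (medial_axis X) 0.
Proof.
apply: contrapT => /not_closure_medial_axis[r r0 uniq].
have [_ reg0] := X0; have [_ sq] := SQX0.
have Xz : X 0 by case: reg0.
(* Then [2 * t < r], so nearest points are unique on the ball required by [normal_ball]. *)
pose t := r / 4; have t0 : 0 < t by rewrite divr_gt0.
have half0 : 0 < 1 / 2 :> R by lra.
have [d d0 dP] := tangent_flat reg0 half0.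
have [rho [rhod sqrho]] : exists rho, rho <= d /\
    bulge X 0 rho eps / eps ^+ 2 @[eps --> (0 : R)^'+] --> +oo.
  near ((0 : R)^'+) => rho; exists rho; split.
    by near: rho; exact: nbhs_right_le.
  by near: rho.
(* Only one scale is needed: an [eps] at which the bulge is at least [eps ^+ 2 / t]. *)
have [eps [eps0 epsP]] : exists eps, 0 < eps /\
    t^-1 <= bulge X 0 rho eps / eps ^+ 2.
  near ((0 : R)^'+) => eps; exists eps; split; first by near: eps; exact: nbhs_right_gt.
  by near: eps; move/cvgryPge : sqrho; apply.
have e2 : 0 < eps ^+ 2 by rewrite exprn_gt0.
have {}epsP : t^-1 * eps ^+ 2 <= bulge X 0 rho eps by rewrite -ler_pdivlMr.
have B0 : 0 < bulge X 0 rho eps by apply: lt_le_trans epsP; rewrite mulr_gt0// invr_gt0.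
have [x [Xx xrho]] := bulge_gt0 B0.
set z := orth_proj _ _ _; rewrite !subr0 in xrho * => zeps xz.
(* A positive bulge forces [z <> x], so [z] is a genuine projection and not the default. *)
have [|Tz orth] := @orth_projP _ _ 0 (tangent X 0) x.
  by rewrite -/z => zx; move: B0; rewrite -xz zx subrr enorm0 ltxx.
rewrite -/z subr0 in Tz orth.
set b := bulge _ _ _ _ in B0 xz epsP.
(* The normalized normal part of [x], for which [dot v x = b]. *)
pose v := b^-1 *: (x - z).
have v1 : enorm v = 1 by rewrite enormZ xz gtr0_norm ?invr_gt0// mulVf// gt_eqF.
have vT w : tangent X 0 w -> dot v w = 0 by move=> Tw; rewrite dotZl orth// mulr0.
have vflat e d' : (forall y, X y -> enorm (y - 0) <= d' ->
    exists2 w, tangent X 0 w & enorm (y - 0 - w) <= e * enorm (y - 0)) ->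
    forall y, X y -> enorm y <= d' -> dot v y <= e * enorm y.
  move=> flat y Xy yd; have := flat y Xy; rewrite !subr0 => /(_ yd)[w Tw yw].
  apply: le_trans yw; have := dot_le v (y - w).
  by rewrite v1 mul1r dotDr dotNr (vT w)// subr0.
have vx : dot v x = b.
  have -> : x = (x - z) + z by rewrite subrK.
  by rewrite dotDr (vT z)// addr0 dotZl -enorm_sqr xz expr2 mulKf// gt_eqF.
have x2 : enorm x ^+ 2 = b ^+ 2 + eps ^+ 2.
  rewrite -[x](subrK z) enorm_sqr; move: xz (orth z Tz); move: (x - z) => w wb wz.
  by rewrite !dotE (dotC z w) wz -!enorm_sqr wb zeps; ring.
have xhalf : b <= 1 / 2 * enorm x.
  by rewrite -vx; apply: (vflat _ d) => //; exact: le_trans rhod.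
have : 2 * t * dot v x <= enorm x ^+ 2.
  apply: (normal_ball closedX Xz v1 t0) => //.
    by move=> e /(tangent_flat reg0)[d' d'0 d'P]; exists d' => //; exact: vflat.
  by move=> c y y' ct; apply: uniq; rewrite subr0; apply: le_lt_trans ct _; rewrite /t; lra.
rewrite vx x2 => le_x2.
have le_b2 : b ^+ 2 <= (1 / 2) ^+ 2 * (b ^+ 2 + eps ^+ 2).
  by rewrite -x2 -exprMn ler_sqr ?nnegrE ?mulr_ge0 ?enorm_ge0//; exact: ltW.
have le_e2 : eps ^+ 2 <= t * b by rewrite -ler_pdivrMl.
have : 0 < t * b by rewrite mulr_gt0.
(* Flatness with factor [1 / 2] gives [b ^+ 2 <= eps ^+ 2 / 3], so [2 * t * b <= b ^+ 2 + eps ^+ 2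
   <= 4 / 3 * (t * b)], which is impossible for [0 < t * b]. *)
lra.
Unshelve. all: by end_near. Qed.
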